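(* Let $(X,\mathsf d)$ be an extended metric space, $K\in\mathbb R$, $E:X\to\mathbb R\cup\{+\infty\}$ lower semicontinuous, $\mu$ a probability measure on $X$ with finite variance, and $\epsilon\ge0$. Assume there is an $\mathrm{EVI}_K$ gradient flow $(y_t)_{t>0}$ of $E$ starting from a point $y\in X$ with $\int_X\mathsf d^2(y,z)\,d\mu(z)\le\mathrm{Var}(\mu)+\epsilon$. Then for all $t>0$, $$E(y_t)\le\int_XE(z)\,d\mu(z)-\frac K2\mathrm{Var}(\mu)+\frac{\epsilon}{2I_K(t)},\qquad I_K(t)=\int_0^te^{Kr}\,dr.$$ In particular, if $\mu$ has a barycenter $\bar y$ and there is an $\mathrm{EVI}_K$ gradient flow of $E$ starting from $\bar y$, then $$E(\bar y)\le\int_XE(z)\,d\mu(z)-\frac K2\int_X\mathsf d^2(\bar y,z)\,d\mu(z).$$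
   Context: Extended metric space: $\mathsf d:X\times X\to[0,\infty]$ symmetric, triangle inequality, $\mathsf d(x,y)=0$ iff $x=y$. $\mathrm{Var}(\mu)=\inf_{x\in X}\int\mathsf d^2(x,z)\,d\mu(z)$; a barycenter is a minimizer. $\mathrm{EVI}_K$ gradient flow of $E$ starting from $y_0$: a locally absolutely continuous curve $(0,\infty)\ni t\mapsto y_t$ with $y_t\to y_0$ in $\mathsf d$ as $t\to0$ such that for every $z\in\mathrm D(E)=\{E<\infty\}$ with $\mathsf d(z,y_t)<\infty$ for some (hence all) $t>0$: $\frac12\frac d{dt}\mathsf d^2(y_t,z)+\frac K2\mathsf d^2(y_t,z)\le E(z)-E(y_t)$ for a.e. $t>0$; if $y_0\notin\mathrm D(E)$ one requires additionally $\liminf_{t\downarrow0}E(y_t)\ge E(y_0)$ and $\mathsf d(y_t,w)\to\mathsf d(y_0,w)$ for all $w\in\overline{\mathrm D(E)}$. *)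

(* Defs.v *)
From HB Require Import structures.
From mathcomp Require Import all_boot all_order all_algebra.
From mathcomp Require Import all_classical all_reals all_analysis.
Set Implicit Arguments. Unset Strict Implicit. Unset Printing Implicit Defensive.
Import Order.TTheory GRing.Theory Num.Theory.
Import numFieldNormedType.Exports.
Local Open Scope classical_set_scope.
Local Open Scope ring_scope.
Local Open Scope ereal_scope.

Section Defs.
Context {R : realType} {X : Type}.
Variable dist : X -> X -> \bar R.

Definition ext_metric : Prop :=
  [/\ (forall x y, 0 <= dist x y),
      (forall x y, dist x y = dist y x),
      (forall x y z, dist x z <= dist x y + dist y z) &
      (forall x y, dist x y = 0 <-> x = y)].

Definition dsq (x z : X) : \bar R := dist x z * dist x z.

Definition dopen (A : set X) : Prop :=
  forall x, A x -> exists r : R, (0 < r)%R /\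
    forall x', dist x x' < r%:E -> A x'.

Definition dclosure (A : set X) : set X :=
  [set w | forall r : R, (0 < r)%R -> exists2 x, A x & dist w x < r%:E].

Definition dlsc (E : X -> \bar R) : Prop :=
  forall x (M : R), M%:E < E x -> exists r : R, (0 < r)%R /\
    forall x', dist x x' < r%:E -> M%:E < E x'.

Definition domE (E : X -> \bar R) : set X := [set x | E x < +oo].

Definition loc_abs_cont (y : R -> X) : Prop :=
  exists m : R -> R,
    (forall a b : R, (0 < a)%R -> (a <= b)%R ->
       (@lebesgue_measure R).-integrable `[a, b] (EFin \o m)) /\
    (forall s t : R, (0 < s)%R -> (s <= t)%R ->
       dist (y s) (y t) <= \int[@lebesgue_measure R]_(r in `[s, t]) (m r)%:E).

Definition EVI_flow (K : R) (E : X -> \bar R) (y0 : X) (y : R -> X) : Prop :=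
  [/\ loc_abs_cont y,
      (fun t => dist (y t) y0) @ 0^'+ --> 0,
      (forall z, domE E z ->
         (exists t : R, (0 < t)%R /\ dist z (y t) < +oo) ->
         let f := fun t => fine (dsq (y t) z) in
         {ae @lebesgue_measure R, forall t : R, (0 < t)%R ->
            derivable f t 1 /\
            (((derive1 f t) / 2 + K / 2 * f t)%R)%:E <= E z - E (y t)}) &
      (~ domE E y0 ->
         (forall M : R, M%:E < E y0 -> \forall t \near 0^'+, M%:E < E (y t)) /\
         (forall w, dclosure (domE E) w ->
            (fun t => dist (y t) w) @ 0^'+ --> dist y0 w))].

Section Prob.
Context {d : measure_display} {T : measurableType d}.
Variable P : probability T R.
Variable dT : T -> T -> \bar R.

Definition Var : \bar R :=
  ereal_inf [set \int[P]_z (dT x z * dT x z) | x in [set: T]].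
End Prob.

End Defs.

Definition IK {R : realType} (K t : R) : R :=
  Rintegral (@lebesgue_measure R) `[0%R, t] (fun r => expR (K * r)).

(* Main.v *)
Require Import Defs.
From HB Require Import structures.
From mathcomp Require Import all_boot all_order all_algebra.
From mathcomp Require Import all_classical all_reals all_analysis.
From mathcomp Require Import measurable_realfun ring lra.
Import Order.TTheory GRing.Theory Num.Theory.
Import numFieldNormedType.Exports.
Local Open Scope classical_set_scope.
Local Open Scope ring_scope.
Local Open Scope ereal_scope.

(** The energy is nonincreasing along the flow, so integrating the EVI over
    (0, t) gives, for every z,
    [e^{Kt} d(y_t,z)^2 / 2 - d(y_0,z)^2 / 2 <= I_K(t) (E z - E(y_t))].
    Integrating in z against mu and bounding the first term from below by the
    variance yields the first claim, because [e^{Kt} - 1 = K I_K(t)]; the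
    barycenter inequality is the limit t -> 0 for eps = 0. The same pointwise
    bound makes the negative part of E mu-integrable. *)

(** * Monotonicity of absolutely continuous functions with nonpositive derivative almost
    everywhere *)

Section AbsolutelyContinuous.
Local Open Scope ring_scope.
Context {R : realType}.
Notation leb := (@lebesgue_measure R).
Implicit Types (a b s t x y e : R) (n g : R -> R) (P : R -> Prop).

(** Take the supremum [c] of the points up to which [P] holds throughout. The limit hypothesis gives
    [P c], and if [c < b] the step hypothesis pushes past [c], against its being an upper bound. *)
Lemma real_induction a b P : P a ->
  (forall x, a <= x -> x < b -> P x ->
     exists2 e, 0 < e & forall y, x < y -> y < x + e -> y <= b -> P y) ->
  (forall x, a < x -> x <= b -> (forall y, a <= y -> y < x -> P y) -> P x) ->
  a <= b -> P b.
Proof.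
move=> Pa Pstep Plim ab.
pose S := [set x | a <= x <= b /\ forall y, a <= y -> y <= x -> P y].
have Sa : S a.
  split; first by rewrite lexx.
  by move=> y ay ya; rewrite (_ : y = a)//; apply/eqP; rewrite eq_le ya.
have Sub : has_ubound S by exists b => x [/andP[]].
have supS : has_sup S by split => //; exists a.
set c := sup S.
have ac : a <= c by exact: ub_le_sup.
have cb : c <= b by apply: ge_sup; [exists a | move=> x [/andP[]]].
have below y : a <= y -> y < c -> P y.
  move=> ay yc.
  have [x [_ Sx]] := @sup_adherent _ S (c - y) ltac:(by rewrite subr_gt0) supS.
  by rewrite subKr => /ltW yx; exact: Sx.
have Pc : P c.
  move: ac; rewrite le_eqVlt => /predU1P[<-//|ac].
  exact: Plim.
move: (cb); rewrite le_eqVlt => /predU1P[<-//|cltb].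
have [e e0 He] := Pstep c ac cltb Pc.
pose z := Num.min (c + e / 2) b.
have cz : c < z by rewrite /z lt_min cltb andbT ltrDl divr_gt0.
suff /(ub_le_sup Sub) : S z by rewrite leNgt cz.
split; first by rewrite (le_trans ac (ltW cz))/= /z ge_min lexx orbT.
move=> y ay yz; have [yc|cy|->//] := ltgtP y c; first exact: below.
apply: He => //.
  by rewrite (le_lt_trans yz)// /z gt_min ltrD2l ltr_pdivrMr// mulr_natr mulr2n ltrDl e0.
by rewrite (le_trans yz)// /z ge_min lexx orbT.
Qed.

(** Absolute continuity relative to a fixed density [n]: only the constant [C] depends on the
    function, so sums and products keep the same control. *)
Definition ac_on n a b g := exists2 C, 0 <= C &
  forall s t, a <= s -> s <= t -> t <= b ->
    `|g t - g s| <= C * Rintegral leb `[s, t] n.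

Section control.
Variable n : R -> R.
Hypothesis n_ge0 : forall x, 0 <= n x.
Hypothesis n_int : leb.-integrable setT (EFin \o n).

Let nS (A : set R) : measurable A -> leb.-integrable A (EFin \o n).
Proof. by move=> mA; exact: integrableS n_int. Qed.

Lemma small_Rintegral e : 0 < e -> exists2 r, 0 < r &
  forall A, measurable A -> (leb A < r%:E)%E -> Rintegral leb A n < e.
Proof.
move=> e0; have [r [r0 H]] := integral_normr_continuous n_int e0.
exists r => // A mA /(H _ mA); congr (_ < _).
by apply: eq_Rintegral => x _; rewrite ger0_norm.
Qed.

Lemma small_Rintegral_itv e : 0 < e -> exists2 r, 0 < r &
  forall s t, s <= t -> t - s < r -> Rintegral leb `[s, t] n < e.
Proof.
move=> /small_Rintegral[r r0 H]; exists r => // s t st str; apply: H => //.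
rewrite lebesgue_measure_itv/= lte_fin; case: ifPn => _; last by rewrite lte_fin.
by rewrite -EFinD lte_fin.
Qed.

Lemma Rintegral_itv_ge0 s t : 0 <= Rintegral leb `[s, t] n.
Proof. by apply: Rintegral_ge0 => x _; exact: n_ge0. Qed.

Lemma Rintegral_itv_cat s x t : s <= x -> x <= t ->
  Rintegral leb `[s, t] n = Rintegral leb `[s, x] n + Rintegral leb `[x, t] n.
Proof.
move=> sx xt; have := @Rintegral_itvB _ n (BLeft s) (BRight t) x (nS _ (measurable_itv _)) sx xt.
rewrite Rintegral_itv_obnd_cbnd; last exact: nS.
by move=> <-; rewrite addrC subrK.
Qed.

End control.

(* No covering argument is needed: the exceptional null set lies in an open set
   [U] on which the control density has integral at most [e1]. On [U] the
   increments of [g] are charged to that integral, elsewhere to the derivative,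
   and real induction glues the two local estimates. *)
Lemma nonincreasing_ae_derive n a b g : (forall x, 0 <= n x) ->
  leb.-integrable setT (EFin \o n) -> ac_on n a b g ->
  {ae leb, forall x, a < x -> x < b -> derivable g x 1 /\ derive1 g x <= 0} ->
  a <= b -> g b <= g a.
Proof.
move=> n0 nint [C C0 gC] gae ab; apply/ler_addgt0Pr => e e0.
(* The total error will be at most [e1 * (b - a) + C * e1]; the extra 1 keeps the denominator
   positive. *)
pose e1 := e / (b - a + C + 1).
have den0 : 0 < b - a + C + 1 by rewrite ltr_wpDl// addr_ge0// subr_ge0.
have e10 : 0 < e1 by rewrite divr_gt0.
have [r r0 rP] := @small_Rintegral n n0 nint _ e10.
(* The endpoint [a] joins the exceptional set because the derivative is only controlled strictly
   inside the interval; it is thereby covered by [U]. *)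
have [N [mN N0 subN]] : leb.-negligible
    (~` [set x | a < x -> x < b -> derivable g x 1 /\ derive1 g x <= 0] `|` [set a]).
  by apply: negligibleU => //; exists [set a]; split => //; exact: lebesgue_measure_set1.
have Noo : (leb N < +oo)%E by rewrite N0.
have [U [oU NU UN]] := lebesgue_regularity_outer mN Noo r0.
have mU : measurable U by exact: open_measurable.
have Ur : (leb U < r%:E)%E.
  have : (leb (N `|` (U `\` N)) <= leb N + leb (U `\` N))%E.
    by apply: measureU2 => //; exact: measurableD.
  by rewrite (setDUK NU) N0 add0e => /le_lt_trans; apply.
have IU := rP _ mU Ur.
pose nU := n \_ U.
have nU0 x : 0 <= nU x by rewrite /nU patchE; case: ifP.
have nUint : leb.-integrable setT (EFin \o nU).
  rewrite -restrict_EFin; apply/integrable_restrict => //.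
  by rewrite setTI; exact: integrableS nint.
pose W x := Rintegral leb `[a, x] nU.
have WE x y : a <= x -> x <= y -> W y = W x + Rintegral leb `[x, y] nU.
  by move=> ax xy; rewrite /W (@Rintegral_itv_cat nU nUint a x y ax xy).
suff : g b <= g a + (e1 * (b - a) + C * W b).
  move/le_trans; apply; rewrite lerD2l.
  have Wb : W b <= e1.
    rewrite /W /nU -Rintegral_mkcondr; apply: le_trans (ltW IU).
    rewrite setIC Rintegral_mkcondr; apply: le_Rintegral => //.
    - rewrite -restrict_EFin; apply/integrable_restrict => //.
      by apply: integrableS nint => //; exact: measurableI.
    - exact: integrableS nint.
    - by move=> x _; rewrite patchE; case: ifP.
  have -> : e = e1 * (b - a + C + 1) by rewrite /e1 divfK// gt_eqF.
  have := ler_wpM2l C0 Wb; nra.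
apply: (@real_induction a b (fun x => g x <= g a + (e1 * (x - a) + C * W x))) => //.
- by rewrite subrr mulr0 add0r /W set_itv1 Rintegral_set1 mulr0 addr0.
- move=> x ax xb Hx; have [Ux|nUx] := pselect (U x).
    have [d /= d0 Hd] : \forall d \near 0^'+, `]x - d, x + d[ `<=` U.
      exact: open_itvoo_subset.
    exists (d / 2); first by rewrite divr_gt0.
    move=> y xy yd yb; rewrite (WE x y)//; last exact/ltW.
    have -> : Rintegral leb `[x, y] nU = Rintegral leb `[x, y] n.
      apply: eq_Rintegral => z; rewrite inE/= in_itv/= => /andP[xz zy].
      rewrite /nU mem_set//; apply: (Hd (d / 2)) => /=.
      - by rewrite sub0r normrN gtr0_norm ?divr_gt0// ltr_pdivrMr// mulr_natr mulr2n ltrDl.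
      - by rewrite divr_gt0.
      - rewrite in_itv/=; apply/andP; split; lra.
    have := gC x y ax (ltW xy) yb; rewrite ler_norml => /andP[_].
    have : 0 <= e1 * (y - x) by rewrite mulr_ge0 ?(ltW e10)// subr_ge0 ltW.
    move=> *; lra.
  have Nx : ~ N x by move=> /NU.
  have {}ax : a < x.
    rewrite lt_neqAle ax andbT; apply/negP => /eqP ae; apply: Nx; apply: subN; right.
    by rewrite /= ae.
  have [dg dg0] : derivable g x 1 /\ derive1 g x <= 0.
    by apply: contrapT => H; apply: Nx; apply: subN; left => /= H'; exact/H/H'.
  have : is_derive x 1 g (derive1 g x) by rewrite derive1E; exact/derivableP.
  (* Carathéodory's form [g y - g x = G y * (y - x)] has [G] continuous at [x] with [G x <= 0 < e1],
     so just to the right of [x] the slope stays below [e1]. *)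
  move/is_derive1_caratheodory => [G [gG cG Gx]].
  have : \forall z \near x, G z < e1 by apply: (cvgr_lt (G x) cG); rewrite Gx (le_lt_trans dg0).
  move=> [d /= d0 Hd]; exists d => // y xy yd yb.
  have Gy : G y < e1 by apply: Hd; rewrite /= distrC gtr0_norm ?subr_gt0// ltrBlDl.
  have := gG y.
  have : G y * (y - x) <= e1 * (y - x) by rewrite ler_wpM2r ?subr_ge0 ?ltW.
  rewrite (WE x y (ltW ax) (ltW xy)).
  have : 0 <= C * Rintegral leb `[x, y] nU by rewrite mulr_ge0// Rintegral_itv_ge0.
  move=> *; lra.
(* Left limits: [g] varies by at most [h] between [x] and a nearby earlier [y]. Dividing [h] by
   [C + 1] covers [C = 0] as well. *)
- move=> x ax xb Hx; apply/ler_addgt0Pr => h h0.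
  have C10 : 0 < C + 1 by rewrite ltr_wpDl.
  have [d d0 Hd] := @small_Rintegral_itv n n0 nint (h / (C + 1)) ltac:(by rewrite divr_gt0).
  pose y := Num.max a (x - d / 2).
  have yx : y < x by rewrite /y gt_max ax/= ltrBlDr ltrDl divr_gt0.
  have ay : a <= y by rewrite /y le_max lexx.
  have yd : x - d / 2 <= y by rewrite /y le_max lexx orbT.
  have := Hx y ay yx.
  have {}Hd : Rintegral leb `[y, x] n < h / (C + 1) by apply: Hd; [exact: ltW|lra].
  have := gC y x ay (ltW yx) xb; rewrite ler_norml => /andP[_].
  have : C * Rintegral leb `[y, x] n <= h.
    rewrite (@le_trans _ _ ((C + 1) * (h / (C + 1))))//; last by rewrite mulrC divfK ?gt_eqF.
    by rewrite ler_pM ?Rintegral_itv_ge0// ?lerDl// ltW.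
  rewrite (WE y x ay (ltW yx)).
  have : 0 <= C * Rintegral leb `[y, x] nU by rewrite mulr_ge0// Rintegral_itv_ge0.
  have : e1 * (y - a) <= e1 * (x - a) by rewrite ler_wpM2l ?(ltW e10)// lerD2r ltW.
  move=> *; lra.
Qed.

End AbsolutelyContinuous.

(** * A Gronwall inequality from an almost everywhere differential inequality *)

Section Gronwall.
Local Open Scope ring_scope.
Context {R : realType}.
Notation leb := (@lebesgue_measure R).
Implicit Types (K a b s t x C : R) (m f g : R -> R).

(** The density is [|m| + 1] on [[a, b]], extended by 0 to be integrable on the whole line. The
    added 1 makes it dominate lengths, so that Lipschitz functions are controlled by the same
    density. *)
Lemma control_density a b m : leb.-integrable `[a, b] (EFin \o m) ->
  exists n : R -> R, [/\ forall x, 0 <= n x,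
    leb.-integrable setT (EFin \o n),
    forall s t, a <= s -> t <= b ->
      Rintegral leb `[s, t] m <= Rintegral leb `[s, t] n &
    forall s t, a <= s -> s <= t -> t <= b -> t - s <= Rintegral leb `[s, t] n].
Proof.
move=> mint; pose n0 x := `|m x| + 1.
have sub s t : a <= s -> t <= b -> `[s, t] `<=` `[a, b].
  move=> as_ tb x /=; rewrite !in_itv/= => /andP[sx xt].
  by rewrite (le_trans as_)//= (le_trans xt).
have intS h s t : a <= s -> t <= b -> leb.-integrable `[a, b] (EFin \o h) ->
    leb.-integrable `[s, t] (EFin \o h).
  by move=> as_ tb; apply: integrableS => //; exact: sub.
have cst1 s t : leb.-integrable `[s, t] (EFin \o cst 1).
  by apply: continuous_compact_integrable;
    [exact: segment_compact | apply: continuous_subspaceT => x; exact: cvg_cst].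
have n0int : leb.-integrable `[a, b] (EFin \o n0).
  have -> : EFin \o n0 = (abse \o (EFin \o m)) \+ (EFin \o cst 1) by exact/funext.
  by apply: integrableD => //; exact: integrable_abse.
exists (n0 \_ `[a, b]).
have n0E s t : a <= s -> t <= b ->
    Rintegral leb `[s, t] (n0 \_ `[a, b]) = Rintegral leb `[s, t] n0.
  move=> as_ tb; apply: eq_Rintegral => x /set_mem /(sub _ _ as_ tb) xab.
  by rewrite /patch mem_set.
split.
- by move=> x; rewrite patchE; case: ifP => // _; rewrite addr_ge0.
- by rewrite -restrict_EFin; apply/integrable_restrict => //; rewrite setTI.
- move=> s t as_ tb; rewrite n0E//; apply: le_Rintegral => //; [exact: intS..|].
  by move=> x _; rewrite (le_trans (ler_norm _))// lerDl.
- move=> s t as_ st tb; rewrite n0E//.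
  have -> : t - s = Rintegral leb `[s, t] (cst 1).
    have st_leb : leb `[s, t] = (t - s)%:E.
      rewrite lebesgue_measure_itv/= lte_fin.
      by move: st; rewrite le_eqVlt => /predU1P[->|->]; rewrite ?ltxx ?subrr.
    by rewrite Rintegral_cst// mul1r -[LHS]/(fine (t - s)%:E) -st_leb.
  by apply: le_Rintegral => //; [exact: intS | move=> x _; rewrite lerDr].
Qed.

Section closure.
Variables (n : R -> R) (a b : R).
Hypothesis n_ge0 : forall x, 0 <= n x.
Hypothesis n_int : leb.-integrable setT (EFin \o n).
Hypothesis n_itv : forall s t, a <= s -> s <= t -> t <= b ->
  t - s <= Rintegral leb `[s, t] n.

Let I_ge0 s t : 0 <= Rintegral leb `[s, t] n.
Proof. exact: Rintegral_itv_ge0. Qed.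

Lemma ac_on_bounded g : ac_on n a b g ->
  exists2 B, 0 <= B & forall x, a <= x -> x <= b -> `|g x| <= B.
Proof.
move=> [C C0 gC]; exists (`|g a| + C * Rintegral leb `[a, b] n).
  by rewrite addr_ge0// mulr_ge0.
move=> x ax xb; rewrite -[g x](subrK (g a)) addrC (le_trans (ler_normD _ _))//.
rewrite lerD2l (le_trans (gC a x _ ax xb))// ler_wpM2l//.
by rewrite (@Rintegral_itv_cat _ _ n_int a x b ax xb) lerDl.
Qed.

Lemma ac_on_lipschitz g C : 0 <= C ->
  (forall s t, a <= s -> s <= t -> t <= b -> `|g t - g s| <= C * (t - s)) ->
  ac_on n a b g.
Proof.
move=> C0 gC; exists C => // s t as_ st tb; rewrite (le_trans (gC s t as_ st tb))//.
by rewrite ler_wpM2l// n_itv.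
Qed.

Lemma ac_on_cst C : ac_on n a b (cst C).
Proof. by apply: (@ac_on_lipschitz _ 0) => // *; rewrite subrr normr0 mul0r. Qed.

Lemma ac_onD f g : ac_on n a b f -> ac_on n a b g ->
  ac_on n a b (fun x => f x + g x).
Proof.
move=> [C C0 fC] [D D0 gD]; exists (C + D); first exact: addr_ge0.
move=> s t as_ st tb; rewrite opprD addrACA (le_trans (ler_normD _ _))//.
by rewrite mulrDl lerD// ?fC ?gD.
Qed.

Lemma ac_onM f g : ac_on n a b f -> ac_on n a b g ->
  ac_on n a b (fun x => f x * g x).
Proof.
move=> fac gac; have [B B0 fB] := ac_on_bounded _ fac.
have [B' B'0 gB'] := ac_on_bounded _ gac.
move: fac gac => [C C0 fC] [D D0 gD]; exists (B * D + C * B').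
  by rewrite addr_ge0// mulr_ge0.
move=> s t as_ st tb.
have -> : f t * g t - f s * g s = f t * (g t - g s) + (f t - f s) * g s by ring.
rewrite (le_trans (ler_normD _ _))// !normrM mulrDl lerD//.
- rewrite -mulrA ler_pM//; last exact: gD.
  by apply: fB => //; exact: le_trans st.
- rewrite mulrAC ler_pM//; first exact: fC.
  by apply: gB' => //; exact: le_trans tb.
Qed.

End closure.

(* Closed form of [IK] (see [IK_expint]), with the degenerate case [K = 0] apart. *)
Definition expint K t := if K == 0 then t else (expR (K * t) - 1) / K.

(** Written without division, the identity covers [K = 0] too; the coefficient [K / 2] of the
    variance comes from it. *)
Lemma expR_expint K t : expR (K * t) = 1 + K * expint K t.
Proof.
rewrite /expint; case: eqVneq => [->|K0]; first by rewrite !mul0r expR0 addr0.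
by rewrite [K * (_ / _)]mulrC divfK// addrC subrK.
Qed.

Lemma expint0 K : expint K 0 = 0.
Proof. by rewrite /expint mulr0 expR0 subrr mul0r if_same. Qed.

Lemma is_derive_expRM K t : is_derive t 1 (fun r => expR (K * r)) (K * expR (K * t)).
Proof.
rewrite mulrC; apply: (@is_derive1_comp _ expR (fun r => K * r)).
rewrite -[X in is_derive _ _ _ X]mulr1; exact: is_deriveZ.
Qed.

Lemma continuous_expRM K : continuous (fun r => expR (K * r)).
Proof.
move=> t; apply: differentiable_continuous; apply/derivable1_diffP.
by have [] := is_derive_expRM K t.
Qed.

Lemma is_derive_expint K t : is_derive t 1 (expint K) (expR (K * t)).
Proof.
have [K0|K0] := eqVneq K 0.
  have -> : expint K = id by apply/funext => r; rewrite /expint K0 eqxx.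
  by rewrite K0 mul0r expR0; exact: is_derive_id.
have -> : expint K = (fun r => K^-1 * (expR (K * r) + cst (-1) r)).
  by apply/funext => r; rewrite /expint (negbTE K0) mulrC.
have -> : expR (K * t) = K^-1 * (K * expR (K * t) + 0) by rewrite addr0 mulKf.
apply: is_deriveZ; apply: is_deriveD; exact: is_derive_expRM.
Qed.

Lemma continuous_expint K : continuous (expint K).
Proof.
move=> t; apply: differentiable_continuous; apply/derivable1_diffP.
by have [] := is_derive_expint K t.
Qed.

Lemma expint_MVT K s t : s <= t ->
  exists2 c, c \in `[s, t] & expint K t - expint K s = expR (K * c) * (t - s).
Proof.
move=> st; apply: MVT_segment => //; first by move=> x _; exact: is_derive_expint.
by apply: continuous_subspaceT; exact: continuous_expint.
Qed.

Lemma expint_gt0 K t : 0 < t -> 0 < expint K t.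
Proof.
move=> t0; have [c _] := expint_MVT K _ _ (ltW t0).
by rewrite expint0 !subr0 => ->; rewrite mulr_gt0// expR_gt0.
Qed.

Lemma IK_expint K t : 0 < t -> IK K t = expint K t.
Proof.
move=> t0; rewrite /IK /Rintegral (@continuous_FTC2 _ _ (expint K))//.
- by rewrite expint0 sube0.
- by apply: continuous_subspaceT; exact: continuous_expRM.
- split.
  + by move=> x _; have [] := is_derive_expint K x.
  + by apply: cvg_at_right_filter; exact: continuous_expint.
  + by apply: cvg_at_left_filter; exact: continuous_expint.
- by move=> x _; rewrite derive1E; apply: derive_val; exact: is_derive_expint.
Qed.

(** With the integrating factor [expR (K * x)], the function
    [expR (K * x) * f x - 2 * c * expint K x] has derivative [2 * expR (K * x) * (f' / 2 + K / 2 * f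
    - c) <= 0] almost everywhere, hence is nonincreasing. *)
Lemma ae_gronwall K c n a b f : 0 <= a -> a <= b -> (forall x, 0 <= n x) ->
  leb.-integrable setT (EFin \o n) ->
  (forall s t, a <= s -> s <= t -> t <= b -> t - s <= Rintegral leb `[s, t] n) ->
  ac_on n a b f ->
  {ae leb, forall x, a < x -> x < b ->
     derivable f x 1 /\ derive1 f x / 2 + K / 2 * f x <= c} ->
  expR (K * b) * f b / 2 - expR (K * a) * f a / 2 <= c * (expint K b - expint K a).
Proof.
move=> a0 ab n0 nint nitv fac fae.
pose g x := expR (K * x) * f x + (- 2 * c) * expint K x.
have Jac : ac_on n a b (expint K).
  apply: (@ac_on_lipschitz n a b nitv _ (expR (`|K| * b))); first exact: expR_ge0.
  move=> s t as_ st tb; have [x + ->] := expint_MVT K _ _ st.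
  rewrite in_itv/= => /andP[sx xt].
  have x0 : 0 <= x by rewrite (le_trans a0)// (le_trans as_).
  rewrite normrM (gtr0_norm (expR_gt0 _)) ger0_norm ?subr_ge0//.
  rewrite ler_wpM2r ?subr_ge0// ler_expR (le_trans (ler_norm _))//.
  by rewrite normrM (ger0_norm x0) ler_wpM2l// (le_trans xt).
have gac : ac_on n a b g.
  apply: ac_onD; apply: ac_onM => //; last exact: ac_on_cst.
  (* The exponential inherits its control from [expint], which is Lipschitz on [[a, b]] by the mean
     value theorem. *)
  rewrite (_ : (fun _ => _) = (fun x => cst 1 x + cst K x * expint K x)).
    by apply: ac_onD; [exact: ac_on_cst|apply: ac_onM => //; exact: ac_on_cst].
  by apply/funext => x; rewrite expR_expint.
suff : g b <= g a by rewrite /g => H; lra.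
apply: (@nonincreasing_ae_derive _ n) => //.
apply: (@filterS _ _ (ae_filter_ringOfSetsType leb) _ _ _ fae) => x H ax xb; have {H}[df fc] := H ax xb.
have fx : is_derive x 1 f (derive1 f x) by rewrite derive1E; exact/derivableP.
have : is_derive x 1 g ((expR (K * x) * derive1 f x + f x * (K * expR (K * x)))
   + (- 2 * c) * expR (K * x)).
  apply: is_deriveD; last by apply: is_deriveZ; exact: is_derive_expint.
  exact: (is_deriveM (is_derive_expRM K x) fx).
move=> [dg]; rewrite -derive1E => ->; split => //.
have := expR_gt0 (K * x); nra.
Qed.

End Gronwall.

(** * Metric regularity of locally absolutely continuous curves *)

Section Flow.
Context {R : realType} {X : Type}.
Variable dist : X -> X -> \bar R.
Hypothesis hd : ext_metric dist.
Notation leb := (@lebesgue_measure R).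

Let dist_ge0 x y : 0 <= dist x y. Proof. by case: hd. Qed.
Let distC x y : dist x y = dist y x. Proof. by case: hd. Qed.
Let dist_tri x y z : dist x z <= dist x y + dist y z. Proof. by case: hd. Qed.
Let dist_eq0 x y : dist x y = 0 <-> x = y. Proof. by case: hd. Qed.
Let distK {x y} : dist x y < +oo -> (fine (dist x y))%:E = dist x y.
Proof. by move=> ?; rewrite fineK// ge0_fin_numE. Qed.

Lemma dsq_ge0 x y : 0 <= dsq dist x y. Proof. exact: mule_ge0. Qed.

Lemma dsq_EFin {x y} : dist x y < +oo ->
  dsq dist x y = (fine (dist x y) * fine (dist x y))%:E.
Proof. by move=> xy; rewrite /dsq -(distK xy). Qed.

Lemma loc_abs_cont_control (y : R -> X) (a b : R) : loc_abs_cont dist y ->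
  (0 < a)%R -> (a <= b)%R ->
  exists n : R -> R, [/\ (forall x, 0 <= n x)%R,
    leb.-integrable setT (EFin \o n),
    (forall s t, a <= s -> s <= t -> t <= b -> t - s <= Rintegral leb `[s, t] n)%R &
    forall s t : R, (a <= s)%R -> (s <= t)%R -> (t <= b)%R ->
      dist (y s) (y t) <= (Rintegral leb `[s, t] n)%:E].
Proof.
move=> [m [mint mdist]] a0 ab.
have [n [n0 nint mn nitv]] := control_density a b _ (mint a b a0 ab).
exists n; split => // s t as_ st tb.
have s0 : (0 < s)%R by exact: lt_le_trans as_.
rewrite (le_trans (mdist s t s0 st))//.
rewrite -[leLHS]fineK; first by rewrite lee_fin; exact: mn.
by apply: integrable_fin_num => //; exact: mint.
Qed.

Section curve.
Variable y : R -> X.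
Hypothesis yac : loc_abs_cont dist y.

Lemma curve_dist_lty (s t : R) : (0 < s)%R -> (0 < t)%R -> dist (y s) (y t) < +oo.
Proof.
wlog st : s t / (s <= t)%R.
  move=> H s0 t0; have [st|/ltW ts] := leP s t; first exact: H.
  by rewrite distC; exact: H.
move=> s0 t0; have [n [_ _ _ H]] := loc_abs_cont_control _ _ _ yac s0 st.
by rewrite (le_lt_trans (H s t _ st _))// ltry.
Qed.

Lemma curve_dist_lty_all (z : X) (s t : R) : (0 < s)%R -> (0 < t)%R ->
  dist (y s) z < +oo -> dist (y t) z < +oo.
Proof.
move=> s0 t0 sz; rewrite (le_lt_trans (dist_tri _ (y s) _))//.
by rewrite lte_add_pinfty// curve_dist_lty.
Qed.

Lemma curve_continuous (s e : R) : (0 < s)%R -> (0 < e)%R ->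
  exists2 r : R, (0 < r)%R & forall t : R, (`|t - s| < r)%R -> dist (y s) (y t) < e%:E.
Proof.
(* The curve is only controlled away from time 0, hence the window [[s / 2, s + 1]] and a radius cut
   so as to remain in it. *)
move=> s0 e0; have s20 : (0 < s / 2)%R by rewrite divr_gt0.
have [n [n0 nint _ H]] := loc_abs_cont_control _ (s / 2)%R (s + 1)%R yac s20 ltac:(lra).
have [r r0 rP] := small_Rintegral_itv _ n0 nint _ e0.
exists (Num.min r (Num.min (s / 2) 1))%R; first by rewrite !lt_min r0 s20 ltr01.
move=> t; rewrite !lt_min !ltr_norml => /and3P[/andP[t1 t2] /andP[t3 t4] /andP[t5 t6]].
have [st|ts] := leP s t.
- by rewrite (le_lt_trans (H s t _ _ _)) ?lte_fin ?rP//; lra.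
- by rewrite distC (le_lt_trans (H t s _ _ _)) ?lte_fin ?rP//; lra.
Qed.

(** By the reverse triangle inequality the distance to [z] is controlled with constant 1, and its
    square is a product of controlled functions. *)
Lemma ac_on_dsq (z : X) (n : R -> R) (a b : R) : (0 < a)%R ->
  (forall x, 0 <= n x)%R -> leb.-integrable setT (EFin \o n) ->
  (forall s t, a <= s -> s <= t -> t <= b -> t - s <= Rintegral leb `[s, t] n)%R ->
  (forall s t : R, (a <= s)%R -> (s <= t)%R -> (t <= b)%R ->
     dist (y s) (y t) <= (Rintegral leb `[s, t] n)%:E) ->
  dist (y a) z < +oo -> ac_on n a b (fun t => fine (dsq dist (y t) z)).
Proof.
move=> a0 n0 nint nitv H az.
have fin t : (a <= t)%R -> dist (y t) z < +oo.
  by move=> at_; apply: curve_dist_lty_all az => //; exact: lt_le_trans at_.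
have uac : ac_on n a b (fun t => fine (dist (y t) z)).
  exists 1%R => // s t as_ st tb; rewrite mul1r.
  have as0 := fin s as_; have at0 := fin t (le_trans as_ st).
  have := H s t as_ st tb; set I := Rintegral _ _ _ => sI.
  have sty : dist (y s) (y t) < +oo by rewrite (le_lt_trans sI)// ltry.
  move: sI (dist_tri (y s) (y t) z) (dist_tri (y t) (y s) z).
  rewrite (distC (y t) (y s)) -(distK as0) -(distK at0) -(distK sty) -!EFinD !lee_fin.
  by move=> *; rewrite ler_norml; apply/andP; split; lra.
have [C C0 HC] := @ac_onM R n a b n0 nint _ _ uac uac.
exists C => // s t as_ st tb; rewrite !dsq_EFin ?fin//; first exact: HC.
exact: le_trans st.
Qed.

End curve.

Lemma EFin_of_lty (x : \bar R) : x != -oo -> x < +oo -> exists v, x = v%:E.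
Proof. by case: x => // v _ _; exists v. Qed.

(** * Consequences of the EVI: energy monotonicity and the integrated inequality *)

Section evi.
Variables (K : R) (E : X -> \bar R) (y0 : X) (y : R -> X).
Hypothesis E_Nyoo : forall x, E x != -oo.
Hypothesis E_lsc : dlsc dist E.
Hypothesis y_evi : EVI_flow dist K E y0 y.

Let yac : loc_abs_cont dist y. Proof. by case: y_evi. Qed.

(** Bounding the energy below by [c] along the curve turns the right-hand side of the EVI into the
    constant [e - c], to which Gronwall applies. *)
Lemma evi_gronwall (z : X) (a b e c : R) : (0 < a)%R -> (a <= b)%R ->
  E z = e%:E -> dist (y a) z < +oo ->
  (forall r : R, (a < r)%R -> (r < b)%R -> c%:E <= E (y r)) ->
  (expR (K * b) * fine (dsq dist (y b) z) / 2
   - expR (K * a) * fine (dsq dist (y a) z) / 2 <= (e - c) * (expint K b - expint K a))%R.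
Proof.
move=> a0 ab Ez az cE.
have [n [n0 nint nitv H]] := loc_abs_cont_control _ _ _ yac a0 ab.
apply: (@ae_gronwall R K (e - c)%R n a b (fun t => fine (dsq dist (y t) z))) => //.
- exact: ltW.
- exact: ac_on_dsq.
have [_ _ evi _] := y_evi.
have zE : domE E z by rewrite /domE/= Ez ltry.
have zy : exists t : R, (0 < t)%R /\ dist z (y t) < +oo by exists a; rewrite distC.
apply: (@filterS _ _ (ae_filter_ringOfSetsType leb) _ _ _ (evi z zE zy)) => x /= Hx ax xb.
have [df fle] := Hx (lt_trans a0 ax); split => //.
(* An infinite [E (y x)] would make the right-hand side of the EVI [-oo], against its real left-hand
   side. *)
move: fle (cE x ax xb) (E_Nyoo (y x)); rewrite Ez.
by case: (E (y x)) => [v|//|//]; rewrite -EFinB !lee_fin => *; lra.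
Qed.

(* If [E (y s) = M < E (y t)], let [c] be the last time before [t] at which the
   energy is at most [M]. The EVI tested at [z = y c] forces the curve to stay
   at [y c] on [[c, t]], although the energy exceeds [M] after [c]. *)
Lemma evi_energy_nonincreasing (s t : R) : (0 < s)%R -> (s <= t)%R ->
  E (y t) <= E (y s).
Proof.
move=> s0 st; rewrite leNgt; apply/negP => Est.
have [M EM] : exists M, E (y s) = M%:E.
  by apply: EFin_of_lty => //; rewrite (lt_le_trans Est)// leey.
rewrite EM in Est.
pose S := [set r : R | (s <= r <= t)%R /\ E (y r) <= M%:E].
have Ss : S s by split; [rewrite lexx | rewrite EM].
have Sub : has_ubound S by exists t => x [/andP[]].
have supS : has_sup S by split => //; exists s.
set c := sup S.
have sc : (s <= c)%R by exact: ub_le_sup.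
have ct : (c <= t)%R by apply: ge_sup; [exists s | move=> x [/andP[]]].
have c0 : (0 < c)%R by exact: lt_le_trans sc.
(* The supremum belongs to [S], by lower semicontinuity of [E] and continuity of the curve. *)
have Ec : E (y c) <= M%:E.
  rewrite leNgt; apply/negP => /E_lsc[r [r0 Hr]].
  have [h h0 Hh] := curve_continuous _ yac _ _ c0 r0.
  have [x Sx cx] := sup_adherent h0 supS.
  have xc : (x <= c)%R by exact: ub_le_sup.
  have xch : (`|x - c| < h)%R.
    by rewrite -/c in cx; rewrite ltr_norml; apply/andP; split; lra.
  by have := Hr (y x) (Hh x xch); rewrite ltNge Sx.2.
have {}ct : (c < t)%R.
  by rewrite lt_neqAle ct andbT; apply/eqP => ctE; move: Ec; rewrite ctE leNgt Est.
have after (r : R) : (c < r)%R -> (r <= t)%R -> M%:E < E (y r).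
  move=> cr rt; rewrite ltNge; apply/negP => Er.
  have : S r by split => //; rewrite rt (le_trans sc (ltW cr)).
  by move/(ub_le_sup Sub); rewrite leNgt cr.
have cc : dist (y c) (y c) = 0 by exact/dist_eq0.
have [v Ev] : exists v, E (y c) = v%:E.
  by apply: EFin_of_lty => //; rewrite (le_lt_trans Ec)// ltry.
rewrite Ev lee_fin in Ec.
(* The initial term vanishes because the test point is [y c], and the right-hand side is nonpositive
   because [v <= M]; this leaves a nonpositive squared distance. *)
have := @evi_gronwall (y c) c t v M c0 (ltW ct) Ev ltac:(by rewrite cc)
  (fun r cr rt => ltW (after r cr (ltW rt))).
rewrite {2}/dsq cc mul0e /= mulr0 mul0r subr0.
have J : (0 <= expint K t - expint K c)%R.
  have [x _ ->] := expint_MVT K _ _ (ltW ct).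
  by rewrite mulr_ge0 ?expR_ge0// subr_ge0 ltW.
have tc := curve_dist_lty _ yac _ _ (lt_trans c0 ct) c0.
rewrite dsq_EFin//= => F; have : (fine (dist (y t) (y c)) = 0)%R.
  have E1 : (fine (dist (y t) (y c)) * fine (dist (y t) (y c)) <= 0)%R.
    rewrite -(pmulr_rle0 _ (expR_gt0 (K * t))).
    have : ((v - M) * (expint K t - expint K c) <= 0)%R by rewrite mulr_le0_ge0// subr_le0.
    by move=> ?; lra.
  by apply/eqP; rewrite -sqrf_eq0 expr2 eq_le E1 -expr2 sqr_ge0.
move=> tc0; have /dist_eq0 yE : dist (y t) (y c) = 0 by rewrite -(distK tc) tc0.
by move: (after t ct (lexx _)); rewrite yE Ev lte_fin ltNge Ec.
Qed.

(** Gronwall on [[r, t]], with the energy bounded below by its value at [t], followed by [r -> 0]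
    and division by [IK K t]. The terms are placed so that no difference of infinities occurs on
    either side. *)
Lemma evi_integrated (z : X) (t c : R) : (0 < t)%R -> c%:E <= E (y t) ->
  (expR (K * t) / (2 * IK K t))%:E * dsq dist (y t) z + c%:E <=
  E z + (1 / (2 * IK K t))%:E * dsq dist y0 z.
Proof.
move=> t0 cE; rewrite (IK_expint _ _ t0); set J := expint K t.
have J0 : (0 < J)%R by exact: expint_gt0.
have [[e Ee]|Ez] : (exists e, E z = e%:E) \/ E z = +oo.
  by move: (E_Nyoo z); case: (E z) => [e _|_|//]; [left; exists e | right].
- have [z0|] := ltP (dist y0 z) +oo; last first.
    rewrite leye_eq => /eqP z0; rewrite {2}/dsq z0 mulyy gt0_muley ?lte_fin ?divr_gt0 ?mulr_gt0//.
    by rewrite Ee addey// leey.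
  have [_ ylim _ _] := y_evi.
  have [fin lim0] := (fine_cvgP _ _).1 ylim.
  pose D := fine (dist y0 z).
  (* The distance from [y r] to [z] is replaced by the larger [dist (y r) y0 + D], whose limit
     follows directly from the convergence of the curve to [y0]. *)
  have near_bound : \forall r \near 0^'+,
      (expR (K * t) * fine (dsq dist (y t) z) / 2 <=
       expR (K * r) * ((fine (dist (y r) y0) + D) * (fine (dist (y r) y0) + D)) / 2
       + (e - c) * (J - expint K r))%R.
    near=> r.
    have r0 : (0 < r)%R by near: r; exact: nbhs_right_gt.
    have rt : (r <= t)%R by near: r; exact: nbhs_right_le.
    have rfin : dist (y r) y0 < +oo by rewrite -ge0_fin_numE//; near: r.
    have rz : dist (y r) z < +oo.
      by rewrite (le_lt_trans (dist_tri _ y0 _))// lte_add_pinfty.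
    have := @evi_gronwall z r t e c r0 rt Ee rz (fun x rx xt =>
      le_trans cE (evi_energy_nonincreasing _ _ (lt_trans r0 rx) (ltW xt))).
    rewrite -/J lerBlDr => /le_trans; apply; rewrite addrC lerD2r.
    rewrite ler_pM2r ?invr_gt0// ler_pM2l ?expR_gt0// dsq_EFin//=.
    have tri : (fine (dist (y r) z) <= fine (dist (y r) y0) + D)%R.
      by rewrite -lee_fin EFinD !distK.
    by rewrite ler_pM// fine_ge0.
  have : (expR (K * t) * fine (dsq dist (y t) z) / 2 <=
      expR (K * 0) * ((0 + D) * (0 + D)) / 2 + (e - c) * (J - expint K 0))%R.
    apply: (cvgr_to_ge _ near_bound).
    apply: cvgD; last first.
      apply: cvgM; first exact: cvg_cst.
      apply: cvgB; first exact: cvg_cst.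
      by apply: cvg_at_right_filter; exact: continuous_expint.
    apply: cvgM; last exact: cvg_cst.
    apply: cvgM.
      by apply: cvg_at_right_filter; exact: continuous_expRM.
    by apply: cvgM; apply: cvgD => //; exact: cvg_cst.
  rewrite mulr0 expR0 mul1r !add0r expint0 subr0 => Hfin.
  (* Since [fine] sends [+oo] to 0, the real bound says something about the extended distance only
     once the latter is known to be finite. *)
  have tz : dist (y t) z < +oo.
    near (0%R : R)^'+ => r.
    have r0 : (0 < r)%R by near: r; exact: nbhs_right_gt.
    have rfin : dist (y r) y0 < +oo by rewrite -ge0_fin_numE//; near: r.
    have rz : dist (y r) z < +oo.
      by rewrite (le_lt_trans (dist_tri _ y0 _))// lte_add_pinfty.
    exact: (curve_dist_lty_all y yac z r t r0 t0 rz).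
  rewrite (dsq_EFin z0) Ee (dsq_EFin tz) -!EFinM -!EFinD lee_fin.
  move: Hfin; rewrite (dsq_EFin tz)/= -/D; move: (fine _) => u Hq.
  have -> : (expR (K * t) / (2 * J) * (u * u) + c
     = (expR (K * t) * (u * u) / 2 + c * J) / J)%R by field; rewrite gt_eqF.
  have -> : (e + 1 / (2 * J) * (D * D) = (D * D / 2 + e * J) / J)%R.
    by field; rewrite gt_eqF.
  by rewrite ler_pM2r ?invr_gt0//; lra.
- rewrite Ez addye ?leey// -ltNye (lt_le_trans (ltNyr 0))// mule_ge0 ?dsq_ge0//.
  by rewrite lee_fin divr_ge0// mulr_ge0// ltW.
Unshelve. all: by end_near.
Qed.

End evi.
End Flow.

(** * Measurability, and integration of the pointwise bound *)

Section Integration.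
Context {R : realType} {d : measure_display} {X : measurableType d}.
Variable dist : X -> X -> \bar R.
Hypothesis hd : ext_metric dist.
Hypothesis hBorel : @measurable d X = <<s [set A | dopen dist A] >>.

(** Strict superlevel sets are open for [dist], and the rays above a real generate the measurable
    sets of [\bar R]. *)
Lemma dlsc_measurable (f : X -> \bar R) : dlsc dist f -> measurable_fun setT f.
Proof.
move=> flsc; apply: (measurability _ (ErealGenOInfty.measurableE R)).
move=> /= _ [_ [M ->]] <-; rewrite setTI hBorel; apply: sub_gen_smallest => x /=.
rewrite in_itv/= andbT => /flsc[r [r0 Hr]]; exists r; split => // x' /Hr.
by rewrite /= in_itv/= andbT.
Qed.

Lemma dlsc_dist (y : X) : dlsc dist (dist y).
Proof.
have [dist_ge0 distC dist_tri _] := hd.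
have fin a b : dist a b < +oo -> dist a b = (fine (dist a b))%:E.
  by move=> ab; rewrite fineK// ge0_fin_numE.
move=> x M Mx; have [xfin|] := ltP (dist y x) +oo; last first.
  (* Points at finite distance from [x] are, like [x], infinitely far from [y], so any radius
     works. *)
  rewrite leye_eq => /eqP yx; exists 1%R; split => // x' xx'.
  have [x'fin|] := ltP (dist y x') +oo; last by rewrite leye_eq => /eqP ->; exact: ltry.
  have := dist_tri y x' x; rewrite yx leNgt lte_add_pinfty// (distC x').
  by rewrite (lt_trans xx')// ltry.
rewrite (fin _ _ xfin) lte_fin in Mx.
exists (fine (dist y x) - M)%R; split; first by rewrite subr_gt0.
move=> x' xx'.
have [x'fin|] := ltP (dist y x') +oo; last by rewrite leye_eq => /eqP ->; exact: ltry.
have xx'fin : dist x x' < +oo by rewrite (lt_trans xx')// ltry.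
have := dist_tri y x' x; rewrite (distC x').
rewrite (fin _ _ xx'fin) in xx' *.
by move: xx'; rewrite (fin _ _ x'fin) (fin _ _ xfin) -EFinD !lee_fin !lte_fin => *; lra.
Qed.

Lemma measurable_dsq (y : X) : measurable_fun setT (dsq dist y).
Proof. by apply: emeasurable_funM; exact/dlsc_measurable/dlsc_dist. Qed.

Variable mu : probability X R.

(* As [+oo - +oo = -oo] in [\bar R], the conclusion would fail if both the
   positive and the negative part of [E] had infinite integral; the pointwise
   hypothesis rules this out. *)
Lemma le_integral_perturbed (E p q : X -> \bar R) (alpha beta c v w : R) :
  measurable_fun setT E -> measurable_fun setT p -> measurable_fun setT q ->
  (forall z, E z != -oo) -> (forall z, 0 <= p z) -> (forall z, 0 <= q z) ->
  (0 <= alpha)%R -> (0 < beta)%R ->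
  (forall z, alpha%:E * p z + c%:E <= E z + beta%:E * q z) ->
  v%:E <= \int[mu]_z p z -> \int[mu]_z q z <= w%:E ->
  c%:E <= \int[mu]_z E z + (beta * w - alpha * v)%:E.
Proof.
move=> mE mp mq ENy p0 q0 a0 b0 Hpq vp qw.
have bq_ge0 z : 0 <= beta%:E * q z by rewrite mule_ge0// lee_fin ltW.
have mbq : measurable_fun setT (fun z => beta%:E * q z) by exact: measurable_funeM.
have int_bq : \int[mu]_z (beta%:E * q z) <= (beta * w)%:E.
  by rewrite ge0_integralZl ?lee_fin ?(ltW b0)// EFinM lee_wpmul2l ?lee_fin ?(ltW b0).
have bq_integrable : mu.-integrable setT (fun z => beta%:E * q z).
  apply/integrableP; split => //.
  by under eq_integral do rewrite gee0_abs//; rewrite (le_lt_trans int_bq)// ltry.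
(* The pointwise hypothesis gives [E^\- <= |c| + beta * q], whose integral is finite. *)
have Eneg : \int[mu]_z E^\- z < +oo.
  apply: (@le_lt_trans _ _ (\int[mu]_z (`|c|%:E + beta%:E * q z))).
    apply: ge0_le_integral => //.
    - exact: measurable_funeneg.
    - by apply: emeasurable_funD.
    - move=> z _; have := le_trans (leeDr c%:E (mule_ge0 (a0 : 0 <= alpha%:E) (p0 z))) (Hpq z).
      rewrite funenegE ge_max adde_ge0 ?lee_fin// andbT.
      move: (ENy z) (bq_ge0 z); case: (E z) => [e _|_ _ _|//]; last by rewrite leNye.
      case: (_ * q z) => [k _|_ _|//]; last by rewrite addey// leey.
      by rewrite -EFinN -!EFinD !lee_fin => H; have := ler_norm (- c); rewrite normrN; lra.
  rewrite ge0_integralD// ?integral_cst//.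
  by rewrite [X in _ * X]probability_setT mule1 lte_add_pinfty ?ltry// (le_lt_trans int_bq)// ltry.
have Eneg0 : 0 <= \int[mu]_z E^\- z by exact: integral_ge0.
(* If the positive part has infinite integral, then [E] integrates to [+oo] and the bound is
   trivial. *)
have [Epos|] := ltP (\int[mu]_z E^\+ z) +oo; last first.
  have Enegfin : \int[mu]_z E^\- z \is a fin_num by rewrite ge0_fin_numE.
  by rewrite leye_eq => /eqP Epos; rewrite integralE Epos -(fineK Enegfin) leey.
have E_integrable : mu.-integrable setT E.
  apply/integrableP; split => //.
  under eq_integral do rewrite -/((abse \o E) _) fune_abse.
  rewrite ge0_integralD//; first by rewrite lte_add_pinfty.
  - exact: measurable_funepos.
  - exact: measurable_funeneg.
have c_integrable : mu.-integrable setT (fun=> c%:E).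
  exact: finite_measure_integrable_cst.
have Ebq_integrable : mu.-integrable setT (E \+ (fun z => beta%:E * q z)).
  exact: integrableD.
(* With [c] moved to the right both integrands are nonnegative, so they can be compared before [p]
   is known to be integrable. *)
have : alpha%:E * \int[mu]_z p z <= \int[mu]_z (E z + beta%:E * q z - c%:E).
  rewrite -ge0_integralZl//; apply: ge0_le_integral => //.
  - by move=> z _; exact: mule_ge0.
  - exact: measurable_funeM.
  - by apply: emeasurable_funB => //; exact: emeasurable_funD.
  - by move=> z _; rewrite leeBrDr.
rewrite integralB// integralD// integral_cst// [X in _ - _ * X]probability_setT mule1.
have Efin : \int[mu]_z E z \is a fin_num by exact: integrable_fin_num.
have bqfin : \int[mu]_z (beta%:E * q z) \is a fin_num by exact: integrable_fin_num.
have := lee_wpmul2l (a0 : 0 <= alpha%:E) vp.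
move: int_bq; rewrite -(fineK Efin) -(fineK bqfin) => + /le_trans H /H.
by rewrite -EFinM -!EFinD !lee_fin => *; lra.
Qed.

End Integration.

(** * Comparison with the variance, then the limit at a barycenter *)

Theorem theorem5p2 (R : realType) (d : measure_display) (X : measurableType d)
  (dist : X -> X -> \bar R) (hd : ext_metric dist)
  (hBorel : @measurable d X = <<s [set A | dopen dist A] >>)
  (K : R) (E : X -> \bar R) (hEfin : forall x, E x != -oo) (hlsc : dlsc dist E)
  (mu : probability X R) (hvar : Var mu dist < +oo) :
  (forall (eps : R) (y : X) (yt : R -> X), (0 <= eps)%R ->
     EVI_flow dist K E y yt ->
     \int[mu]_z dsq dist y z <= Var mu dist + eps%:E ->
     forall t : R, (0 < t)%R ->
       E (yt t) <= \int[mu]_z E z - (K / 2 * fine (Var mu dist))%:E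
                   + (eps / (2 * IK K t))%:E) /\
  (forall (ybar : X) (yt : R -> X),
     (forall x, \int[mu]_z dsq dist ybar z <= \int[mu]_z dsq dist x z) ->
     EVI_flow dist K E ybar yt ->
     E ybar <= \int[mu]_z E z - (K / 2)%:E * \int[mu]_z dsq dist ybar z).
Proof.
have [dist_ge0 distC _ _] := hd.
have mE : measurable_fun setT E by exact: dlsc_measurable hlsc.
have Var0 : 0 <= Var mu dist.
  by apply: le_ereal_inf_tmp => _ [x _ <-]; apply: integral_ge0 => z _; exact: mule_ge0.
have VarE : Var mu dist = (fine (Var mu dist))%:E by rewrite fineK// ge0_fin_numE.
have main (eps : R) (y : X) (yt : R -> X) (t : R) : (0 < t)%R ->
    EVI_flow dist K E y yt ->
    \int[mu]_z dsq dist y z <= Var mu dist + eps%:E ->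
    E (yt t) <= \int[mu]_z E z - (K / 2 * fine (Var mu dist))%:E
                + (eps / (2 * IK K t))%:E.
  move=> t0 evi yVar; have J0 := expint_gt0 K t t0.
  have I0 : (0 < 2 * IK K t)%R by rewrite IK_expint// mulr_gt0.
  (* [E (yt t)] may a priori be [+oo]. *)
  suff H c : c%:E <= E (yt t) -> c%:E <= \int[mu]_z E z -
      (K / 2 * fine (Var mu dist))%:E + (eps / (2 * IK K t))%:E.
    move: H (hEfin (yt t)); case: (E (yt t)) => [e|H _|//]; first by move=> H _; exact: H.
    rewrite leye_eq; apply/eqP/eqyP => A _; apply: H; exact: leey.
  move=> cE; set v := fine (Var mu dist).
  (* As [expR (K * t) = 1 + K * IK K t], the constants regroup into the form [beta * w - alpha * v]
     with [w = v + eps]. *)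
  have -> : \int[mu]_z E z - (K / 2 * v)%:E + (eps / (2 * IK K t))%:E =
      \int[mu]_z E z + (1 / (2 * IK K t) * (v + eps)
                       - expR (K * t) / (2 * IK K t) * v)%:E.
    rewrite -addeA -EFinN -EFinD IK_expint// expR_expint; congr (_ + _%:E).
    by field; rewrite gt_eqF.
  apply: (@le_integral_perturbed R d X mu E (dsq dist (yt t)) (dsq dist y)) => //.
  - exact: measurable_dsq.
  - exact: measurable_dsq.
  - by move=> z; exact: mule_ge0.
  - by move=> z; exact: mule_ge0.
  - by rewrite divr_ge0 ?expR_ge0// ltW.
  - by rewrite divr_gt0.
  - by move=> z; exact: evi_integrated evi _ _ _ t0 cE.
  (* The point [yt t] competes in the infimum defining the variance. *)
  - by rewrite -VarE; apply: ereal_inf_lbound; exists (yt t).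
  - by rewrite EFinD -VarE.
split=> [eps y yt _ evi yVar t t0|ybar yt bary evi]; first exact: (main _ y).
have VarBar : Var mu dist = \int[mu]_z dsq dist ybar z.
  apply/eqP; rewrite eq_le; apply/andP; split.
    by apply: ereal_inf_lbound; exists ybar.
  by apply: le_ereal_inf_tmp => _ [x _ <-]; exact: bary.
rewrite -VarBar VarE -EFinM; set v := fine _.
have bound t : (0 < t)%R -> E (yt t) <= \int[mu]_z E z - (K / 2 * v)%:E.
  move=> t0; have := main 0%R ybar yt t t0 evi.
  by rewrite VarBar adde0 mul0r adde0 -VarBar; apply.
(* Passage to [t -> 0] by contradiction: were [E ybar] above the bound, lower semicontinuity would
   keep [E] above it near [ybar], where the flow lies at small times. *)
rewrite leNgt; apply/negP => lt_rhs.
have [M rhsE] : exists M, \int[mu]_z E z - (K / 2 * v)%:E = M%:E.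
  apply: EFin_of_lty; last by rewrite (lt_le_trans lt_rhs)// leey.
  (* The bound dominates the energy at time 1, which is not [-oo]. *)
  by apply/eqP => rhs; have := bound 1%R ltr01; rewrite rhs leeNy_eq; exact/negP.
rewrite rhsE in lt_rhs bound.
have [r [r0 Hr]] := hlsc _ _ lt_rhs.
have [_ ylim _ _] := evi.
have [fin lim0] := (fine_cvgP _ _).1 ylim.
near (0%R : R)^'+ => t.
have t0 : (0 < t)%R by near: t; exact: nbhs_right_gt.
suff /Hr : dist ybar (yt t) < r%:E by rewrite ltNge bound.
have tfin : dist (yt t) ybar \is a fin_num by near: t.
rewrite distC -(fineK tfin) lte_fin.
by near: t; exact: (cvgr_lt _ lim0).
Unshelve. all: by end_near.
Qed.
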